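(* Suppose that the dictionary $\mathbb{V} = \operatorname{span}\{\psi_1,\dots,\psi_N\}$ contains the coordinate functions, with $\psi_i(x) = x_i$ for $i = 1,\dots,d$, and that each component of the vector field belongs to the dictionary, i.e. $f_i \in \mathbb{V}$ for all $i = 1,\dots,d$. Suppose moreover that $f$ is sufficiently smooth such that $x(t;\hat x) = \hat x + t f(\hat x) + \mathcal{O}(t^2)$ as $t \to 0$, uniformly in $\hat x \in \mathbb{X}$. Then the approximated dynamics with coordinate projection, $\hat F_\pi(\hat x) = \hat K_{[1:d]}\Psi(\hat x)$, satisfy $$\hat F_\pi(\hat x) = x(t;\hat x) + \mathcal{O}(t^2) \quad (t \to 0)$$ for all initial conditions $\hat x \in \mathbb{X}$.
   Context: Let $\mathbb{X} \subset \mathbb{R}^d$ be compact, $\eta > 0$, $D := \{x+y : x \in \mathbb{X},\ \|y\| < \eta\}$, and $f = (f_1,\dots,f_d)^\top : D \to \mathbb{R}^d$ Lipschitz continuous. For $\hat x \in \mathbb{X}$ let $x(\cdot;\hat x)$ be the solution of $\dot x(t) = f(x(t))$, $x(0) = \hat x$; it is assumed to exist in $D$ on $[0,\Delta t]$ for all $\hat x \in \mathbb{X}$, for a given $\Delta t > 0$. Let $\psi_1,\dots,\psi_N \in L^2(D,\mathbb{R})$ be linearly independent and $\Psi := (\psi_1,\dots,\psi_N)^\top$. With the coordinate functions as first $d$ observables, $\Psi(x) = (x^\top, \bar\Psi(x)^\top)^\top$ with $\bar\Psi : \mathbb{R}^d \to \mathbb{R}^{N-d}$ smooth. For $t \in (0,\Delta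 t]$, $\hat K = \hat K(t) \in \mathbb{R}^{N\times N}$ is the solution of $\min_{K\in\mathbb{R}^{N\times N}} \int_{\mathbb{X}} \|\Psi(x(t;\hat x)) - K\Psi(\hat x)\|_2^2\,\mathrm{d}\hat x$, given by $\hat K = \Psi_Y\Psi_X^{-1}$ with $\Psi_X = \int_{\mathbb{X}} \Psi(\hat x)\Psi(\hat x)^\top\mathrm{d}\hat x$ (assumed invertible) and $\Psi_Y = \int_{\mathbb{X}} \Psi(x(t;\hat x))\Psi(\hat x)^\top\mathrm{d}\hat x$. $\hat K_{[1:d]} \in \mathbb{R}^{d\times N}$ denotes its first $d$ rows. The coordinate projection is $\pi(z) := (z_{[1:d]}, \bar\Psi(z_{[1:d]}))$ for $z\in\mathbb{R}^N$, where $z_{[1:d]}$ is the vector of the first $d$ entries of $z$. The approximated discrete-time dynamics are $\hat F_\pi(x) := \Psi^{-1}\circ\pi(\hat K\Psi(x))$, where $\Psi^{-1}$ takes the first $d$ entries of a point of the form $\Psi(y)$; hence $\hat F_\pi(x) = \hat K_{[1:d]}\Psi(x)$. *)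

(* Defs.v *)
From HB Require Import structures.
From mathcomp Require Import all_boot all_order all_algebra.
From mathcomp Require Import all_classical all_reals all_analysis.

Set Implicit Arguments.
Unset Strict Implicit.
Unset Printing Implicit Defensive.

Import Order.TTheory GRing.Theory Num.Theory.
Import numFieldTopology.Exports numFieldNormedType.Exports.

Local Open Scope classical_set_scope.
Local Open Scope ring_scope.

Definition cV_display : measure_display.
Proof. exact: default_measure_display. Qed.

Section measurable_cV.
Variables (R : realType) (n : nat).

Definition cV_coord (i : 'I_n) (v : 'cV[R]_n) : measurableTypeR R := v i 0.

Let cV_set0 : g_sigma_preimage cV_coord set0.
Proof. exact: sigma_algebra0. Qed.

Let cV_setC A : g_sigma_preimage cV_coord A -> g_sigma_preimage cV_coord (~` A).
Proof. exact: sigma_algebraC. Qed.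

Let cV_bigcup (F : (set 'cV[R]_n)^nat) :
  (forall i, g_sigma_preimage cV_coord (F i)) ->
  g_sigma_preimage cV_coord (\bigcup_i (F i)).
Proof. exact: sigma_algebra_bigcup. Qed.

(* The product sigma-algebra, i.e. the Borel sets of R^n. *)
HB.instance Definition _ := @isMeasurable.Build cV_display
  'cV[R]_n (g_sigma_preimage cV_coord) cV_set0 cV_setC cV_bigcup.

Lemma measurable_cV_coord (i : 'I_n) : measurable_fun setT (cV_coord i).
Proof.
move=> _ Y mY; rewrite setTI; apply: sub_sigma_algebra => /=.
rewrite -bigcup_seq/=; exists i => /=; first by rewrite mem_index_enum.
by exists Y => //; rewrite setTI.
Qed.

Lemma measurable_fun_cVP d (T : measurableType d) (f : T -> 'cV[R]_n) :
  measurable_fun setT f <-> forall i, measurable_fun setT (cV_coord i \o f).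
Proof.
split=> [mf i|mf].
  by apply: measurableT_comp => //; exact: measurable_cV_coord.
move=> _ A mA; rewrite setTI.
suff : g_sigma_preimage cV_coord `<=` [set A | measurable (f @^-1` A)] by exact.
apply: smallest_sub.
  split => /=.
  - by rewrite preimage_set0.
  - by move=> B mB; rewrite setTD preimage_setC; exact: measurableC.
  - by move=> F mF; rewrite preimage_bigcup; exact: bigcup_measurable.
move=> B; rewrite -bigcup_seq/= => -[i _ [C mC <-]] /=.
rewrite setTI -comp_preimage -[X in measurable X]setTI.
exact: mf.
Qed.

End measurable_cV.

Section cons_cV.
Variables (R : realType) (n : nat).

Definition cons_cV (p : measurableTypeR R * 'cV[R]_n) : 'cV[R]_n.+1 :=
  \col_i (if unlift ord0 i is Some j then p.2 j 0 else p.1).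

Definition uncons_cV (v : 'cV[R]_n.+1) : measurableTypeR R * 'cV[R]_n :=
  (v ord0 0, \col_j v (lift ord0 j) 0).

Lemma cons_cVK : cancel cons_cV uncons_cV.
Proof.
move=> [a v]; rewrite /uncons_cV /cons_cV; congr pair.
  by rewrite mxE unlift_none.
by apply/colP => j; rewrite !mxE liftK.
Qed.

Lemma uncons_cVK : cancel uncons_cV cons_cV.
Proof.
by move=> v; apply/colP => i; rewrite mxE; case: unliftP => [j ->|->]; rewrite ?mxE.
Qed.

Lemma measurable_cons_cV : measurable_fun setT cons_cV.
Proof.
apply/measurable_fun_cVP => i.
case: (unliftP ord0 i) => [j ->|->].
  rewrite (_ : _ \o _ = cV_coord j \o snd); last first.
    by apply/funext => p; rewrite /= /cV_coord mxE liftK.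
  by apply: measurableT_comp => //; exact: measurable_cV_coord.
rewrite (_ : _ \o _ = fst) //.
by apply/funext => p; rewrite /= /cV_coord mxE unlift_none.
Qed.

Lemma measurable_uncons_cV : measurable_fun setT uncons_cV.
Proof.
apply: measurable_fun_pair; first exact: (measurable_cV_coord ord0).
apply/measurable_fun_cVP => j.
rewrite (_ : _ \o _ = cV_coord (lift ord0 j)); first exact: measurable_cV_coord.
by apply/funext => v; rewrite /= /cV_coord mxE.
Qed.

End cons_cV.

Section cons_measure.
Variables (R : realType) (n : nat).
Variable mu : {sigma_finite_measure set 'cV[R]_n -> \bar R}.

Definition cons_measure : set 'cV[R]_n.+1 -> \bar R :=
  pushforward (lebesgue_measure \x mu)%E (@cons_cV R n).

Let cons_measure0 : cons_measure set0 = 0%E.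
Proof. by rewrite /cons_measure /pushforward preimage_set0 measure0. Qed.

Let cons_measure_ge0 A : (0 <= cons_measure A)%E.
Proof. by rewrite /cons_measure /pushforward measure_ge0. Qed.

Let cons_measure_sigma_additive : semi_sigma_additive cons_measure.
Proof.
move=> F mF tF mUF; rewrite /cons_measure /pushforward preimage_bigcup.
apply: measure_semi_sigma_additive.
- by move=> k; rewrite -[X in measurable X]setTI; exact: measurable_cons_cV.
- apply/trivIsetP => /= i j _ _ ij; rewrite -preimage_setI.
  by move/trivIsetP : tF => /(_ _ _ _ _ ij) ->//; rewrite preimage_set0.
- rewrite -preimage_bigcup -[X in measurable X]setTI.
  exact: measurable_cons_cV.
Qed.

HB.instance Definition _ := isMeasure.Build _ _ _ cons_measure
  cons_measure0 cons_measure_ge0 cons_measure_sigma_additive.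

Let cons_measure_sigma_finite : sigma_finite setT cons_measure.
Proof.
have /sigma_finiteP[F [TF ndF Foo]] := sigma_finiteT (@lebesgue_measure R).
have /sigma_finiteP[G [TG ndG Goo]] := sigma_finiteT mu.
exists (fun k => @uncons_cV R n @^-1` (F k `*` G k)).
  rewrite -preimage_bigcup (_ : \bigcup_k (F k `*` G k) = setT).
    by rewrite preimage_setT.
  apply/seteqP; split => // -[x y] _.
  have : (setT : set (measurableTypeR R)) x by [].
  have : (setT : set 'cV[R]_n) y by [].
  rewrite TF TG => -[j _ Gy] [i _ Fx]; exists (maxn i j) => //; split => /=.
  - by move: x Fx; exact/subsetPset/ndF/leq_maxl.
  - by move: y Gy; exact/subsetPset/ndG/leq_maxr.
move=> k; have [mF Fk] := Foo k; have [mG Gk] := Goo k; split.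
  rewrite -[X in measurable X]setTI; apply: measurable_uncons_cV => //.
  exact: measurableX.
rewrite /cons_measure /pushforward -comp_preimage (_ : _ \o _ = id).
  by rewrite preimage_id product_measure1E// lte_mul_pinfty// ge0_fin_numE.
by apply/funext => p /=; exact: cons_cVK.
Qed.

HB.instance Definition _ := Measure_isSigmaFinite.Build _ _ _ cons_measure
  cons_measure_sigma_finite.

End cons_measure.

(* Lebesgue measure on R^n (restricted to the Borel sets): the n-fold product of
   the one-dimensional one, starting from the unit mass on R^0. *)
Fixpoint lebesgue_cV (R : realType) (n : nat) :
    {sigma_finite_measure set 'cV[R]_n -> \bar R} :=
  if n is n'.+1 then @cons_measure R n' (lebesgue_cV R n')
  else @dirac _ 'cV[R]_0 0 R.

Lemma lebesgue_cV_box (R : realType) (n : nat) (A : 'I_n -> set R) :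
  (forall i, measurable (A i : set (measurableTypeR R))) ->
  lebesgue_cV R n [set v | forall i, A i (v i 0)] =
    (\prod_(i < n) lebesgue_measure (A i))%E.
Proof.
elim: n A => [|n IHn] A mA.
  by rewrite big_ord0 /= diracE mem_set// => -[].
rewrite big_ord_recl -(IHn (fun j => A (lift ord0 j)))// /= /cons_measure /pushforward.
rewrite -product_measure1E//; first last.
  rewrite (_ : (fun _ => _) = \big[setI/setT]_(j < n)
      (@cV_coord R n j @^-1` A (lift ord0 j))).
    apply: bigsetI_measurable => j _.
    by rewrite -[X in measurable X]setTI; exact: measurable_cV_coord.
  rewrite -bigcap_seq; apply/seteqP; split => v /= vA j; first by move=> _; exact: vA.
  by apply: (vA j); rewrite /= mem_index_enum.
congr (_ _); apply/seteqP; split => [[a v] /= H|[a v] /= [Ha Hv] i].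
  split=> [|j]; first by have := H ord0; rewrite mxE unlift_none.
  by have := H (lift ord0 j); rewrite mxE liftK.
by rewrite mxE; case: unliftP => [j ->|->].
Qed.

Section observables.
Variables (R : realType) (d : nat).

(* Euclidean norm; the norm `|v| on matrices is the (equivalent) max norm. *)
Definition enorm n (v : 'cV[R]_n) : R := Num.sqrt (\sum_(i < n) v i 0 ^+ 2).

Definition neighborhood (X : set 'cV[R]_d) (eta : R) : set 'cV[R]_d :=
  [set z | exists x y, [/\ X x, enorm y < eta & z = x + y]].

(* Square integrability of a function on D; the carrier of L^2(D). *)
Definition L2_on (D : set 'cV[R]_d) (g : 'cV[R]_d -> R) : Prop :=
  measurable_fun D g /\
  (\int[lebesgue_cV R d]_(x in D) (g x ^+ 2)%:E < +oo)%E.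

(* Linear independence in L^2(D), where functions equal a.e. are identified. *)
Definition L2_independent (D : set 'cV[R]_d) N (psi : 'I_N -> 'cV[R]_d -> R) :=
  forall c : 'I_N -> R,
    {ae lebesgue_cV R d, forall x, D x -> \sum_(i < N) c i * psi i x = 0} ->
    forall i, c i = 0.

Definition in_span_on (D : set 'cV[R]_d) N (psi : 'I_N -> 'cV[R]_d -> R)
    (g : 'cV[R]_d -> R) : Prop :=
  exists c : 'I_N -> R, forall x, D x -> g x = \sum_(i < N) c i * psi i x.

(* C^k in the sense that all iterated partial derivatives of order at most k
   exist and are continuous. *)
Fixpoint Ck m (k : nat) (g : 'cV[R]_d -> 'cV[R]_m) : Prop :=
  continuous g /\
  if k is k'.+1 then
    forall i : 'I_d, (forall x, derivable g x (delta_mx i 0)) /\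
      Ck k' (fun x => 'D_(delta_mx i 0) g x)
  else True.

Definition smooth m (g : 'cV[R]_d -> 'cV[R]_m) : Prop := forall k, Ck k g.

(* y solves y' = f(y), y(0) = x0 inside D on [0, T]. Two-sided derivatives are
   required on the open interval only, so that y is unconstrained outside
   [0, T]; for continuous f, one-sided differentiability at 0 and T follows. *)
Definition is_solution (D : set 'cV[R]_d) (f : 'cV[R]_d -> 'cV[R]_d) (T : R)
    (x0 : 'cV[R]_d) (y : R -> 'cV[R]_d) : Prop :=
  [/\ y 0 = x0,
      forall t, 0 <= t <= T -> D (y t),
      {within `[0, T], continuous y} &
      forall t, 0 < t < T -> is_derive t 1 y (f (y t))].

End observables.

Section edmd.
Variables (R : realType) (d m : nat).
Variable Psibar : 'cV[R]_d -> 'cV[R]_m.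

(* The first d of the N = d + m observables are the coordinate functions. *)
Definition Psi (x : 'cV[R]_d) : 'cV[R]_(d + m) := col_mx x (Psibar x).

Definition observable (i : 'I_(d + m)) (x : 'cV[R]_d) : R := Psi x i 0.

Definition Psi_X (X : set 'cV[R]_d) : 'M[R]_(d + m) :=
  \matrix_(i, j) \int[lebesgue_cV R d]_(x in X) (observable i x * observable j x).

Definition edmd_cost (X : set 'cV[R]_d) (flow : 'cV[R]_d -> 'cV[R]_d)
    (K : 'M[R]_(d + m)) : \bar R :=
  (\int[lebesgue_cV R d]_(x in X)
     (enorm (Psi (flow x) - K *m Psi x) ^+ 2)%:E)%E.

(* K minimizes the least-squares cost; when Psi_X is invertible the minimizer
   is unique. *)
Definition is_edmd (X : set 'cV[R]_d) (flow : 'cV[R]_d -> 'cV[R]_d)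
    (K : 'M[R]_(d + m)) : Prop :=
  forall K', (edmd_cost X flow K <= edmd_cost X flow K')%E.

Definition coord_proj (z : 'cV[R]_(d + m)) : 'cV[R]_(d + m) :=
  col_mx (usubmx z) (Psibar (usubmx z)).

(* Left inverse of Psi, extended to all of R^N by taking the first d entries. *)
Definition Psi_inv (z : 'cV[R]_(d + m)) : 'cV[R]_d := usubmx z.

Definition F_pi (K : 'M[R]_(d + m)) (x : 'cV[R]_d) : 'cV[R]_d :=
  Psi_inv (coord_proj (K *m Psi x)).

Lemma F_piE K x : F_pi K x = usubmx K *m Psi x.
Proof. by rewrite /F_pi /Psi_inv col_mxKu mul_usub_mx. Qed.

End edmd.

(* Main.v *)
Require Import Defs.
From HB Require Import structures.
From mathcomp Require Import all_boot all_order all_algebra.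
From mathcomp Require Import all_classical all_reals all_analysis.
From mathcomp Require Import measurable_realfun.
From mathcomp Require Import ring lra.

(** Since the vector field lies in the span of the dictionary, the Euler step
    xh + t f(xh) is the value at xh of a linear combination of the observables;
    let w_i be its coefficient row for the i-th coordinate.  By the assumed
    expansion the residual of w_i, as a predictor of the i-th coordinate of the
    flow, is at most e = O(t^2) on X.

    The least-squares cost is a sum over the rows of K, so replacing the i-th row
    of the minimizer by w_i cannot lower it.  Hence the i-th row K_i fits in
    mean square as well as w_i does, and by the parallelogram inequality the
    integral over X of ((K_i - w_i) Psi)^2 is at most 4 e^2 vol(X)
    ([edmd_row_mean_square]).  The passage from this mean-square estimate to a
    pointwise one uses the invertibility of the Gram matrix Psi_X: the entries of
    (K_i - w_i) Psi_X are integrals of (K_i - w_i) Psi against bounded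
    observables, hence O(e) ([gram_le_mean_square]), and multiplying by the inverse
    of Psi_X bounds K_i - w_i itself ([edmd_row_error]).  No power of t is lost,
    because Psi_X does not depend on t.

    One analytic point needs care.  The cost integrand involves the flow, whose
    measurability in the initial condition would itself require a Gronwall
    argument.  The integral of a non-negative function is defined as a supremum
    over the simple functions below it, so it remains monotone for arbitrary
    functions, and it is additive as soon as one of the two summands is measurable
    ([ge0_lower_integralD]).  In the comparison of costs the only terms to be split
    off are constants and squares of linear combinations of observables, which are
    measurable. *)

Set Implicit Arguments.
Unset Strict Implicit.
Unset Printing Implicit Defensive.

Import Order.TTheory GRing.Theory Num.Theory.
Import numFieldTopology.Exports numFieldNormedType.Exports.

Local Open Scope classical_set_scope.
Local Open Scope ring_scope.

(** * Integrals of non-negative functions that may fail to be measurable *)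

Section lower_integral.
Local Open Scope ereal_scope.
Context d (T : measurableType d) (R : realType).
Variables (mu : {measure set T -> \bar R}) (D : set T).
Hypothesis mD : measurable D.

Import HBNNSimple.

Lemma ge0_le_lower_integral (f g : T -> \bar R) :
  (forall x, D x -> 0 <= f x) -> (forall x, D x -> f x <= g x) ->
  \int[mu]_(x in D) f x <= \int[mu]_(x in D) g x.
Proof.
move=> f0 fg; have g0 x : D x -> 0 <= g x.
  by move=> Dx; exact: le_trans (f0 _ Dx) (fg _ Dx).
rewrite !ge0_integralE//; apply: ereal_sup_le => _ [h hf <-]; exists h => // x.
apply: le_trans (hf x) _; rewrite /patch; case: ifPn => // /set_mem; exact: fg.
Qed.

(** A simple function below the extension of [f] by zero vanishes outside [D]. *)
Lemma integral_dominated_nnsfun (h : {nnsfun T >-> R}) (f : T -> \bar R) :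
  (forall x, (h x)%:E <= (f \_ D) x) -> sintegral mu h = \int[mu]_(x in D) (h x)%:E.
Proof.
move=> hf; rewrite -integralT_nnsfun integral_mkcond [RHS]integral_mkcond.
congr (integral mu setT _); apply/funext => x; rewrite /patch in_setT.
case: ifPn => // /negPf xD; have := hf x; rewrite /patch xD lee_fin => h0.
by congr EFin; apply/eqP; rewrite eq_le h0/=.
Qed.

(** If [h] is simple and [h <= q + b], then the positive part of [h - q] is
    measurable and below [b], which bounds the integral of [h] by the right-hand
    side.  Conversely, adding [q] to a simple function below [b] gives a measurable
    function below [q + b]. *)
Lemma ge0_lower_integralD (q : T -> R) (b : T -> \bar R) :
  measurable_fun D q -> (forall x, D x -> (0 <= q x)%R) ->
  (forall x, D x -> 0 <= b x) ->
  \int[mu]_(x in D) ((q x)%:E + b x) =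
    \int[mu]_(x in D) (q x)%:E + \int[mu]_(x in D) b x.
Proof.
move=> mq q0 b0.
have mqE : measurable_fun D (EFin \o q) by exact/measurable_EFinP.
have q0E x : D x -> 0 <= (q x)%:E by move=> Dx; rewrite lee_fin q0.
have qb0 x : D x -> 0 <= (q x)%:E + b x by move=> Dx; rewrite adde_ge0 ?q0E ?b0.
have mh (h : {nnsfun T >-> R}) : measurable_fun D h by exact: measurable_funTS.
apply/eqP; rewrite eq_le; apply/andP; split.
- rewrite [leLHS]ge0_integralE//; apply: ge_ereal_sup => _ [h hqb <-].
  rewrite (integral_dominated_nnsfun hqb).
  pose g x := Num.max 0%R (h x - q x)%R.
  have mg : measurable_fun D (EFin \o g).
    apply/measurable_EFinP; apply: measurable_maxr => //.
    exact: measurable_funB.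
  have g0 x : D x -> 0 <= (g x)%:E by rewrite lee_fin le_max lexx.
  apply: (@le_trans _ _ (\int[mu]_(x in D) ((q x)%:E + (g x)%:E))).
    apply: ge0_le_lower_integral => x Dx; first by rewrite lee_fin.
    by rewrite -EFinD lee_fin -lerBlDl le_max lexx orbT.
  rewrite ge0_integralD// leeD2l//; apply: ge0_le_lower_integral => // x Dx.
  rewrite /g EFin_max ge_max b0//= EFinB leeBlDl//.
  by have := hqb x; rewrite /patch mem_set.
- have [qoo|/eqP qoo] := eqVneq (\int[mu]_(x in D) (q x)%:E) +oo.
    have /(ge0_le_lower_integral q0E) : forall x, D x -> (q x)%:E <= (q x)%:E + b x.
      by move=> x Dx; rewrite leeDl ?b0.
    by rewrite qoo leye_eq => /eqP ->; exact: leey.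
  have qfin : \int[mu]_(x in D) (q x)%:E \is a fin_num.
    by rewrite ge0_fin_numE ?integral_ge0// ltey; exact/eqP.
  rewrite -leeBrDl//.
  rewrite [leLHS]ge0_integralE//; apply: ge_ereal_sup => _ [h hb <-].
  rewrite (integral_dominated_nnsfun hb) leeBrDl// -ge0_integralD//.
  + apply: ge0_le_lower_integral => x Dx.
      by rewrite adde_ge0 ?q0E ?lee_fin.
    by rewrite leeD2l//; have := hb x; rewrite /patch mem_set.
  + by move=> x Dx; rewrite lee_fin.
  + exact/measurable_EFinP.
Qed.
End lower_integral.

(** * From mean-square smallness to small coefficients *)

Section gram.
Context d (T : measurableType d) (R : realType).
Variables (mu : {measure set T -> \bar R}) (D : set T) (N : nat).
Variables (phi : 'I_N -> T -> R) (M : R).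
Hypotheses (M0 : 0 <= M) (mD : measurable D) (muD : (mu D < +oo)%E).
Hypothesis mphi : forall k, measurable_fun D (phi k).
Hypothesis bphi : forall k x, D x -> `|phi k x| <= M.

(** For the family of observables this is [Psi_X], up to conversion. *)
Definition gram : 'M[R]_N := \matrix_(k, l) \int[mu]_(x in D) (phi k x * phi l x).

Definition lincomb (v : 'rV[R]_N) (x : T) : R := \sum_(k < N) v 0 k * phi k x.

Lemma measurable_lincomb v : measurable_fun D (lincomb v).
Proof.
by apply: measurable_sum => k; exact: measurable_funM.
Qed.

Lemma lincomb_le v x : D x -> `|lincomb v x| <= (\sum_(k < N) `|v 0 k|) * M.
Proof.
move=> Dx; rewrite mulr_suml; apply: le_trans (ler_norm_sum _ _ _) _.
by apply: ler_sum => k _; rewrite normrM ler_wpM2l// bphi.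
Qed.

Lemma bounded_fun_integrable (g : T -> R) (B : R) :
  measurable_fun D g -> (forall x, D x -> `|g x| <= B) ->
  mu.-integrable D (EFin \o g).
Proof.
move=> mg gB; apply: measurable_bounded_integrable => //.
exists B; split; first exact: num_real.
by move=> r Br x Dx; apply: le_trans (gB x Dx) (ltW Br).
Qed.

Lemma mulmx_gramE v l :
  (v *m gram) 0 l = \int[mu]_(x in D) (lincomb v x * phi l x).
Proof.
have iphi k : mu.-integrable D (EFin \o (fun x => phi k x * phi l x)).
  apply: (bounded_fun_integrable (B := M * M)) => [|x Dx].
    exact: measurable_funM.
  by rewrite normrM ler_pM ?bphi.
rewrite mxE /Rintegral.
under [in RHS]eq_integral.
  move=> x _; rewrite /lincomb mulr_suml -sumEFin.
  under eq_bigr do rewrite -mulrA EFinM.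
  over.
rewrite (integral_sum mD (fun k => integrableZl mD _ (iphi k))).
rewrite -sum_fine => [|k _].
  apply: eq_bigr => k _; rewrite mxE integralZl// fineM//.
  exact: integrable_fin_num.
by rewrite integralZl// fin_numM//; exact: integrable_fin_num.
Qed.

(** The entry is the integral of [lincomb v] against [phi l], hence at most [M]
    times the integral of the absolute value of [lincomb v]; that one is estimated
    pointwise by [|u| <= e / 2 + u^2 / (2 e)].  With a mean square of order [e^2]
    both terms have order [e], so this weighted inequality does the work of
    Cauchy-Schwarz. *)
Lemma gram_le_mean_square v l (e c : R) : 0 < e ->
  (\int[mu]_(x in D) (lincomb v x ^+ 2)%:E <= (c * e ^+ 2)%:E)%E ->
  `|(v *m gram) 0 l| <= M * (e / 2 * fine (mu D) + c * e / 2).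
Proof.
move=> e0 ms; rewrite mulmx_gramE.
have mu_fin : mu D \is a fin_num by rewrite ge0_fin_numE.
have ml := measurable_lincomb v.
have ilin : mu.-integrable D (EFin \o (fun x => lincomb v x * phi l x)).
  apply: (bounded_fun_integrable (B := ((\sum_(k < N) `|v 0 k|) * M) * M)).
    exact: measurable_funM.
  by move=> x Dx; rewrite normrM ler_pM ?lincomb_le ?bphi.
apply: le_trans (le_normr_Rintegral mD ilin) _.
have isq : mu.-integrable D (EFin \o (fun x => lincomb v x ^+ 2)).
  apply: (bounded_fun_integrable (B := ((\sum_(k < N) `|v 0 k|) * M) ^+ 2)).
    exact: measurable_funX.
  move=> x Dx; rewrite normrX lerXn2r ?nnegrE ?lincomb_le//.
  exact: le_trans (lincomb_le v Dx).
have icst (r : R) : mu.-integrable D (EFin \o cst r).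
  by apply: (bounded_fun_integrable (B := `|r|)) => // x _; exact: lexx.
have isqZ : mu.-integrable D (EFin \o (fun x => (M / (2 * e)) * lincomb v x ^+ 2)).
  exact: (integrableZl mD (M / (2 * e)) isq).
apply: (@le_trans _ _
    (\int[mu]_(x in D) (M * (e / 2) + (M / (2 * e)) * lincomb v x ^+ 2))).
  apply: le_Rintegral => //.
  - exact: integrable_norm ilin.
  - exact: (integrableD mD (icst (M * (e / 2))) isqZ).
  move=> x Dx; rewrite normrM.
  have lM : `|lincomb v x| * `|phi l x| <= M * `|lincomb v x|.
    by rewrite mulrC ler_wpM2r// bphi.
  apply: le_trans lM _; rewrite -[in leRHS]real_normK ?num_real//.
  set a := `|lincomb v x|.
  rewrite -subr_ge0 (_ : _ - _ = M / (2 * e) * (a - e) ^+ 2).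
    by rewrite mulr_ge0 ?sqr_ge0// divr_ge0// mulr_ge0// ltW.
  by field; rewrite gt_eqF.
rewrite (RintegralD mD (icst (M * (e / 2))) isqZ) RintegralZl//.
rewrite [X in X + _](Rintegral_cst mu mD).
have sqle : \int[mu]_(x in D) (lincomb v x ^+ 2) <= c * e ^+ 2.
  by rewrite -lee_fin fineK// integrable_fin_num.
apply: (@le_trans _ _ (M * (e / 2) * fine (mu D) + M / (2 * e) * (c * e ^+ 2))).
  by rewrite lerD2l ler_wpM2l// divr_ge0// mulr_ge0// ltW.
rewrite le_eqVlt; apply/orP; left; apply/eqP; field.
by rewrite gt_eqF.
Qed.
End gram.

(** * Borel sets and bounded sets of R^n *)

Section borel_cV.
Variables (R : realType) (n : nat).
Implicit Types (A : set 'cV[R]_n).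

Lemma cV_ballP (x y : 'cV[R]_n) (e : R) : 0 < e ->
  ball x e y <-> forall i, `|x i 0 - y i 0| < e.
Proof.
move=> e0; split=> [[_ xy] i|xy]; first exact: xy.
by split=> // i j; rewrite (ord1 j); exact: xy.
Qed.

Lemma cV_norm_le (v : 'cV[R]_n) (c : R) : 0 <= c ->
  (forall i, `|v i 0| <= c) -> `|v| <= c.
Proof.
move=> c0 vc; rewrite [`|v|]mx_normrE; apply/bigmax_leP; split=> //= -[i j] _ /=.
by rewrite (ord1 j).
Qed.

Lemma cV_coord_le (v : 'cV[R]_n) i : `|v i 0| <= `|v|.
Proof.
by rewrite [`|v|]mx_normrE; apply/bigmax_geP; right; exists (i, 0).
Qed.

Lemma measurable_box (B : 'I_n -> set R) :
  (forall i, measurable (B i)) -> measurable [set v : 'cV[R]_n | forall i, B i (v i 0)].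
Proof.
move=> mB.
rewrite (_ : [set _ | _] = \big[setI/setT]_(i < n) (@cV_coord R n i @^-1` B i)).
  apply: bigsetI_measurable => i _.
  rewrite -[X in measurable X]setTI.
  by apply: measurable_cV_coord => //; exact: mB.
rewrite -bigcap_seq; apply/seteqP; split => v /= vB i; first by move=> _; exact: vB.
by apply: (vB i); rewrite /= mem_index_enum.
Qed.

(** An open set is the union of the countably many boxes contained in it that have a
    rational centre and a radius of the form [1 / (k + 1)]. *)
Lemma open_measurable_cV A : open A -> measurable A.
Proof.
move=> oA.
pose box (qk : 'cV[rat]_n * nat) : set 'cV[R]_n :=
  [set v | forall i, ball (ratr (qk.1 i 0) : R) (qk.2.+1%:R^-1) (v i 0)].
rewrite (_ : A = \bigcup_qk (if `[< box qk `<=` A >] then box qk else set0)).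
  apply: countable_bigcupT_measurable => //= -[q k].
  case: ifPn => // _; apply: (measurable_box (B := fun i => ball _ _)) => i.
  exact: measurable_ball.
apply/seteqP; split=> [x Ax|x [qk _]]; last by case: asboolP => // H /H.
have /nbhs_ballP[e /= e0 xeA] := open_nbhs_nbhs (conj oA Ax).
have [k ke] : exists k : nat, k.+1%:R^-1 < e / 2.
  have e20 : 0 < e / 2 by rewrite divr_gt0.
  by have [k _ /(_ k (leqnn k)) /= ke] := near_infty_natSinv_lt (PosNum e20); exists k.
have k0 : 0 < k.+1%:R^-1 :> R by rewrite invr_gt0.
have /choice[q xq] : forall i, exists q : rat, `|x i 0 - ratr q| < k.+1%:R^-1.
  move=> i; have [y [xy [q _ qy]]] := @dense_rat R (ball (x i 0) k.+1%:R^-1)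
    (ex_intro _ _ (ballxx _ k0)) (ball_open _ _).
  by exists q; rewrite qy.
exists (\col_i q i, k) => //; case: asboolP => [_ i|].
  by rewrite /ball /= mxE distrC.
case=> v vbox; apply: xeA; apply/cV_ballP => // i.
have := vbox i; have := xq i; rewrite /ball /= mxE => h1 h2.
rewrite -(subrKA (ratr (q i))) (le_lt_trans (ler_normD _ _))//.
by rewrite (splitr e) ltrD//; exact: lt_trans ke.
Qed.

Lemma compact_measurable_cV A : compact A -> measurable A.
Proof.
move=> /compact_closed => /(_ (@norm_hausdorff _ _)) /closed_openC.
by move=> /open_measurable_cV /measurableC; rewrite setCK.
Qed.

Lemma continuous_measurable_cV (g : 'cV[R]_n -> R) : continuous g ->
  measurable_fun setT g.
Proof.
move=> /continuousP cg; apply: (measurability _ (RGenOpens.measurableE R)).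
move=> _ [_ [a [b ->] <-]]; rewrite setTI; apply: open_measurable_cV.
exact/cg/interval_open.
Qed.

(** Transposition carries the product of segments, compact in the space of row
    vectors, onto the closed ball of the max norm. *)
Lemma compact_norm_le (M : R) : compact [set v : 'cV[R]_n | `|v| <= M].
Proof.
have [M0|M0] := ltP M 0.
  rewrite (_ : mkset _ = set0); first exact: compact0.
  by rewrite -subset0 => v /=; rewrite leNgt (lt_le_trans M0).
have cT : continuous (@trmx R 1 n).
  move=> v A /nbhs_ballP[e /= e0 eA]; apply/nbhs_ballP; exists e => //= w [_ vw].
  by apply: eA; apply/cV_ballP => // i; rewrite !mxE; exact: vw.
rewrite (_ : mkset _ = (@trmx R 1 n) @`
    [set v : 'rV[R]_n | forall i, `[- M, M]%classic (v ord0 i)]).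
  apply: continuous_compact; first exact: continuous_subspaceT.
  by apply: (@rV_compact _ _ (fun=> `[- M, M]%classic)) => i; exact: segment_compact.
apply/seteqP; split => [v /= vM|_ [v /= vM <-]] /=.
  exists (v^T); last exact: trmxK.
  move=> i /=; rewrite in_itv /= mxE -ler_norml.
  exact: le_trans (cV_coord_le _ _) vM.
apply: cV_norm_le => // i; rewrite mxE ler_norml.
by have := vM i; rewrite /= in_itv.
Qed.

Lemma bounded_lebesgue_cV_fin A : measurable A -> bounded_set A ->
  (lebesgue_cV R n A < +oo)%E.
Proof.
move=> mA [M [_ AM]].
pose B : set R := `[- (M + 1), M + 1]%classic.
apply: (@le_lt_trans _ _ (lebesgue_cV R n [set v | forall i, B (v i 0)])).
  apply: le_measure; rewrite ?inE//.
    by apply: (measurable_box (B := fun=> B)) => i; exact: measurable_itv.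
  move=> v Av i; rewrite /B /= in_itv /= -ler_norml.
  by apply: le_trans (cV_coord_le _ _) _; apply: AM => //; rewrite ltrDl.
rewrite (lebesgue_cV_box (A := fun=> B)); last first.
  by move=> i; exact: measurable_itv.
rewrite ltey_eq; apply/orP; left.
apply: (big_ind (fun z => z \is a fin_num)) => //; first exact: fin_numM.
by move=> i _; rewrite /B lebesgue_measure_itv/= lte_fin; case: ifP.
Qed.
End borel_cV.

(** * Comparing the minimizer with another predictor, row by row *)

Section edmd_row.
Context (R : realType) (d m : nat).
Variables (Psibar : 'cV[R]_d -> 'cV[R]_m) (X : set 'cV[R]_d).
Variable flow : 'cV[R]_d -> 'cV[R]_d.
Local Notation N := (d + m)%N.
Local Notation psi := (observable Psibar).
Local Notation mu := (lebesgue_cV R d).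

Definition replace_row (K : 'M[R]_N) (i : 'I_N) (w : 'rV[R]_N) : 'M[R]_N :=
  \matrix_(k, l) if k == i then w 0 l else K k l.

Definition residual (v : 'rV[R]_N) (k : 'I_N) (x : 'cV[R]_d) : R :=
  psi k (flow x) - lincomb psi v x.

Lemma edmd_cost_split K i :
  edmd_cost Psibar X flow K =
  (\int[mu]_(x in X) ((residual (row i K) i x ^+ 2)%:E +
    (\sum_(k < N | k != i) residual (row k K) k x ^+ 2)%:E))%E.
Proof.
apply: eq_integral => x _; rewrite -EFinD /enorm sqr_sqrtr; last first.
  by apply: sumr_ge0 => k _; rewrite sqr_ge0.
have residualE k : (Psi Psibar (flow x) - K *m Psi Psibar x) k 0 =
    residual (row k K) k x.
  rewrite [LHS]mxE [X in _ + X]mxE [X in _ - X]mxE; congr (_ - _).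
  by apply: eq_bigr => l _; rewrite [row _ _ _ _]mxE.
rewrite (bigD1 i)//= residualE; congr ((_ + _)%:E).
by apply: eq_bigr => k _; rewrite residualE.
Qed.

Variables (K : 'M[R]_N) (M : R).
Hypotheses (mX : measurable X) (muX : (mu X < +oo)%E) (M0 : 0 <= M).
Hypothesis mpsi : forall k, measurable_fun X (psi k).
Hypothesis bpsi : forall k x, X x -> `|psi k x| <= M.
Hypothesis bflow : forall k x, X x -> `|psi k (flow x)| <= M.
Hypothesis edmdK : is_edmd Psibar X flow K.

(** The cost of the other rows is the same for [K] and for [K] with its [i]-th row
    replaced by [w]; it is finite because all observables are bounded along the
    flow, so it cancels in the comparison of the two costs. *)
Lemma edmd_row_mean_square i w (e : R) : 0 <= e ->
  (forall x, X x -> `|residual w i x| <= e) ->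
  (\int[mu]_(x in X) (lincomb psi (row i K - w) x ^+ 2)%:E
     <= (4 * fine (mu X) * e ^+ 2)%:E)%E.
Proof.
move=> e0 we.
pose rest x : R := \sum_(k < N | k != i) residual (row k K) k x ^+ 2.
have rest0 x : (0 <= (rest x)%:E)%E.
  by rewrite lee_fin sumr_ge0// => k _; rewrite sqr_ge0.
have muXfin : mu X \is a fin_num by rewrite ge0_fin_numE.
have cst_int (r : R) : (\int[mu]_(x in X) r%:E = r%:E * mu X)%E.
  exact: (integral_cst mu mX r%:E).
have rest_fin : (\int[mu]_(x in X) (rest x)%:E)%E \is a fin_num.
  rewrite ge0_fin_numE ?integral_ge0//.
  pose B := \sum_(k < N | k != i) (M + (\sum_(l < N) `|row k K 0 l|) * M) ^+ 2.
  apply: (@le_lt_trans _ _ (\int[mu]_(x in X) B%:E)%E).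
    apply: ge0_le_lower_integral => // x Xx; rewrite lee_fin; apply: ler_sum => k _.
    rewrite -real_normK ?num_real// lerXn2r ?nnegrE//.
      by rewrite addr_ge0// mulr_ge0// sumr_ge0.
    apply: le_trans (ler_normB _ _) _; rewrite lerD ?bflow//.
    exact: (lincomb_le bpsi).
  by rewrite cst_int lte_mul_pinfty// lee_fin sumr_ge0// => k _; rewrite sqr_ge0.
pose q x := lincomb psi (row i K - w) x ^+ 2 / 2.
have q0 x : 0 <= q x by rewrite divr_ge0// sqr_ge0.
have mq : measurable_fun X q.
  apply: measurable_funM => //; apply: measurable_funX.
  exact: measurable_lincomb.
have costD (g : 'cV[R]_d -> R) : measurable_fun X g -> (forall x, X x -> 0 <= g x) ->
  (\int[mu]_(x in X) ((g x)%:E + (rest x)%:E) =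
   \int[mu]_(x in X) (g x)%:E + \int[mu]_(x in X) (rest x)%:E)%E.
  by move=> mg g0; exact: ge0_lower_integralD.
have e2 : 0 <= e ^+ 2 by rewrite sqr_ge0.
(* Parallelogram inequality: (u - v)^2 / 2 <= u^2 + v^2 for the two residuals. *)
have lower : (\int[mu]_(x in X) (q x)%:E + \int[mu]_(x in X) (rest x)%:E <=
    (e ^+ 2)%:E * mu X + edmd_cost Psibar X flow K)%E.
  rewrite -costD// (edmd_cost_split K i) -cst_int -ge0_lower_integralD//; last first.
    by move=> x Xx; rewrite adde_ge0 ?rest0// lee_fin sqr_ge0.
  apply: ge0_le_lower_integral => x Xx; first by rewrite adde_ge0 ?rest0// lee_fin.
  rewrite addeA leeD2r// -EFinD lee_fin /q.
  have -> : lincomb psi (row i K - w) x = residual w i x - residual (row i K) i x.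
    rewrite /residual opprB [RHS]addrC subrKA /lincomb -sumrB.
    by apply: eq_bigr => k _; rewrite !mxE mulrBl.
  have we2 : residual w i x ^+ 2 <= e ^+ 2.
    by rewrite -real_normK ?num_real// ler_sqr ?nnegrE// we.
  move: (residual w i x) (residual (row i K) i x) we2 => u v we2.
  by have := sqr_ge0 (u + v); nra.
have upper : (edmd_cost Psibar X flow K <=
    (e ^+ 2)%:E * mu X + \int[mu]_(x in X) (rest x)%:E)%E.
  apply: le_trans (edmdK (replace_row K i w)) _.
  rewrite (edmd_cost_split _ i) -cst_int -costD//.
  apply: ge0_le_lower_integral => x Xx.
    by rewrite -EFinD lee_fin addr_ge0 ?sqr_ge0// sumr_ge0// => k _; rewrite sqr_ge0.
  apply: leeD; rewrite lee_fin.
    rewrite (_ : row i _ = w); last by apply/rowP => l; rewrite !mxE eqxx.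
    by rewrite -real_normK ?num_real// lerXn2r ?nnegrE// we.
  apply: ler_sum => k /negPf ki.
  by rewrite (_ : row k (replace_row _ _ _) = row k K)//; apply/rowP => l; rewrite !mxE ki.
have qE : (\int[mu]_(x in X) (lincomb psi (row i K - w) x ^+ 2)%:E =
    2%:E * \int[mu]_(x in X) (q x)%:E)%E.
  rewrite -ge0_integralZl//; last first.
  - by move=> x _; rewrite lee_fin.
  - exact/measurable_EFinP.
  by apply: eq_integral => x _; rewrite /q -EFinM mulrC divfK.
rewrite qE; move: lower upper; rewrite -(fineK rest_fin) -(fineK muXfin).
move: (edmd_cost _ _ _ _) => c lower /(leeD2l ((e ^+ 2)%:E * (fine (mu X))%:E)%E).
move=> /(le_trans lower).
case: (\int[mu]_(x in X) (q x)%:E)%E => [I| |] //=.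
  by rewrite -!EFinM -!EFinD !lee_fin; lra.
by move=> _; rewrite gt0_muleNy ?lte_fin// leNye.
Qed.
End edmd_row.

(** * The observables on the neighbourhood of X *)

Section observables_on_neighborhood.
Context (R : realType) (d m : nat).
Variables (X : set 'cV[R]_d) (eta : R).

Lemma coord_le_enorm n (v : 'cV[R]_n) i : `|v i 0| <= enorm v.
Proof.
rewrite -sqrtr_sqr ler_wsqrtr// (bigD1 i)//= lerDl sumr_ge0// => k _.
by rewrite sqr_ge0.
Qed.

Lemma sub_neighborhood : 0 < eta -> X `<=` neighborhood X eta.
Proof.
move=> eta0 y Xy; exists y, 0; split=> //; last by rewrite addr0.
by rewrite /enorm big1 ?sqrtr0// => i _; rewrite mxE expr0n.
Qed.

Lemma neighborhood_bounded : bounded_set X ->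
  exists r, forall y, neighborhood X eta y -> `|y| <= r.
Proof.
move=> [r [_ Xr]]; exists (r + 1 + `|eta|) => _ [y [z [Xy zeta ->]]].
apply: le_trans (ler_normD _ _) _; apply: lerD; first by apply: Xr => //; rewrite ltrDl.
apply: cV_norm_le => // i; apply: le_trans (coord_le_enorm _ _) _.
exact: le_trans (ltW zeta) (ler_norm _).
Qed.

Variable Psibar : 'cV[R]_d -> 'cV[R]_m.
Hypothesis cPsibar : continuous Psibar.

Lemma measurable_observable k : measurable_fun setT (observable Psibar k).
Proof.
apply: continuous_measurable_cV; rewrite /observable /Psi.
case: (split_ordP k) => j ->.
  under eq_fun do rewrite col_mxEu.
  exact: coord_continuous.
under eq_fun do rewrite col_mxEd.
move=> y; apply: (@continuous_comp _ _ _ Psibar (fun v : 'cV[R]_m => v j 0)).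
  exact: cPsibar.
exact: coord_continuous.
Qed.

(** The neighbourhood lies in a closed ball, which is compact, so the bound holds
    not only on [X] but also along trajectories that stay in the neighbourhood. *)
Lemma observable_bounded : bounded_set X ->
  exists2 M : R, 0 <= M &
    forall k y, neighborhood X eta y -> `|observable Psibar k y| <= M.
Proof.
move=> /neighborhood_bounded[r Dr].
have /compact_bounded[M [_ PM]] : compact (Psibar @` [set v | `|v| <= r]).
  by apply: continuous_compact; [exact: continuous_subspaceT|exact: compact_norm_le].
exists (`|r| + `|M + 1|) => [|k y Dy]; first by rewrite addr_ge0.
rewrite /observable /Psi; case: (split_ordP k) => j ->.
  rewrite col_mxEu (le_trans (cV_coord_le _ _))// (le_trans (Dr _ Dy))//.
  by rewrite (le_trans (ler_norm _))// lerDl.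
rewrite col_mxEd (le_trans (cV_coord_le _ _))//.
apply: (@le_trans _ _ (M + 1)).
  by apply: PM; [rewrite ltrDl|exists y => //; exact: Dr].
by rewrite (le_trans (ler_norm _))// lerDr.
Qed.

End observables_on_neighborhood.

(** * Pointwise error of a row of the minimizer *)

Section edmd_row_error.
Context (R : realType) (d m : nat).
Variables (Psibar : 'cV[R]_d -> 'cV[R]_m) (X : set 'cV[R]_d) (M : R).
Hypotheses (mX : measurable X) (muX : (lebesgue_cV R d X < +oo)%E) (M0 : 0 <= M).
Hypothesis mpsi : forall k, measurable_fun X (observable Psibar k).
Hypothesis bpsi : forall k x, X x -> `|observable Psibar k x| <= M.
Hypothesis PsiXunit : Psi_X Psibar X \in unitmx.

(** The constant depends only on [X], the observables and their bound [M], and not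
    on the flow map: this makes the estimate uniform in the time step. *)
Lemma edmd_row_error : exists2 C : R, 0 <= C &
  forall flow K i w e, is_edmd Psibar X flow K ->
  (forall k x, X x -> `|observable Psibar k (flow x)| <= M) -> 0 < e ->
  (forall x, X x -> `|residual Psibar flow w i x| <= e) ->
  forall x, X x -> `|residual Psibar flow (row i K) i x| <= C * e.
Proof.
set V := fine (lebesgue_cV R d X).
have V0 : 0 <= V by rewrite fine_ge0.
pose L := M * (V / 2 + 4 * V / 2).
have L0 : 0 <= L by rewrite mulr_ge0// addr_ge0 ?mulr_ge0// divr_ge0 ?mulr_ge0.
pose S := \sum_(k < d + m) \sum_(l < d + m) L * `|invmx (Psi_X Psibar X) l k|.
have S0 : 0 <= S.
  by apply: sumr_ge0 => k _; apply: sumr_ge0 => l _; rewrite mulr_ge0.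
exists (1 + S * M) => [|flow K i w e edmdK bflow e0 we x Xx].
  by rewrite addr_ge0// mulr_ge0.
pose v := row i K - w.
have vG l : `|(v *m Psi_X Psibar X) 0 l| <= L * e.
  have := edmd_row_mean_square mX muX M0 mpsi bpsi bflow edmdK (ltW e0) we.
  move=> /(gram_le_mean_square M0 mX muX mpsi bpsi l e0) /le_trans; apply.
  by rewrite -/V /L le_eqVlt; apply/orP; left; apply/eqP; field.
have vS : \sum_(k < d + m) `|v 0 k| <= S * e.
  rewrite mulr_suml; apply: ler_sum => k _.
  rewrite -[v](mulmxK PsiXunit) mxE mulr_suml.
  apply: le_trans (ler_norm_sum _ _ _) _; apply: ler_sum => l _.
  by rewrite normrM mulrAC ler_wpM2r.
have -> : residual Psibar flow (row i K) i x =
    residual Psibar flow w i x - lincomb (observable Psibar) v x.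
  rewrite /residual -addrA -opprD /lincomb -big_split/=; congr (_ - _).
  by apply: eq_bigr => k _; rewrite !mxE mulrBl addrC subrK.
apply: le_trans (ler_normB _ _) _; rewrite mulrDl mul1r lerD ?we//.
apply: le_trans (lincomb_le bpsi _ Xx) _.
by rewrite mulrAC ler_wpM2r.
Qed.

End edmd_row_error.

(** * The approximated dynamics *)

Theorem mainTheorem4 (R : realType) (d m : nat)
    (X : set 'cV[R]_d) (eta dt : R)
    (f : 'cV[R]_d -> 'cV[R]_d) (x : R -> 'cV[R]_d -> 'cV[R]_d)
    (Psibar : 'cV[R]_d -> 'cV[R]_m) (K : R -> 'M[R]_(d + m))
    (hX : compact X) (heta : 0 < eta) (hdt : 0 < dt)
    (hf : [lipschitz f y | y in neighborhood X eta])
    (hx : forall xh, X xh ->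
      is_solution (neighborhood X eta) f dt xh (fun t => x t xh))
    (hsmooth : smooth Psibar)
    (hL2 : forall i, L2_on (neighborhood X eta) (observable Psibar i))
    (hindep : L2_independent (neighborhood X eta) (observable Psibar))
    (hPsiX : Psi_X Psibar X \in unitmx)
    (hK : forall t, 0 < t <= dt -> is_edmd Psibar X (x t) (K t))
    (hspan : forall i : 'I_d,
      in_span_on (neighborhood X eta) (observable Psibar) (fun y => f y i 0))
    (hexpansion : exists C : R, \forall t \near 0^'+, forall xh, X xh ->
      `|x t xh - (xh + t *: f xh)| <= C * t ^+ 2) :
  exists C : R, \forall t \near 0^'+, forall xh, X xh ->
    `|F_pi Psibar (K t) xh - x t xh| <= C * t ^+ 2.
Proof.
have DX : X `<=` neighborhood X eta by exact: sub_neighborhood.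
have cPsibar : continuous Psibar by have [] := hsmooth 0%N.
have bX : bounded_set X := compact_bounded hX.
have mX : measurable X := compact_measurable_cV hX.
have muX := bounded_lebesgue_cV_fin mX bX.
have [M M0 bD] := observable_bounded eta cPsibar bX.
have mpsi k : measurable_fun X (observable Psibar k).
  by apply: measurable_funTS; exact: measurable_observable.
have bpsi k y : X y -> `|observable Psibar k y| <= M by move=> /DX /bD.
have [C1 C10 rowE] := edmd_row_error mX muX M0 mpsi bpsi hPsiX.
have [c fE] := choice hspan.
case: hexpansion => C0 near_exp.
exists (C1 * (`|C0| + 1)); near=> t.
have t0 : 0 < t by near: t; exact: nbhs_right_gt.
have tdt : t <= dt by near: t; exact: nbhs_right_le.
have texp : forall xh, X xh -> `|x t xh - (xh + t *: f xh)| <= C0 * t ^+ 2.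
  by near: t.
pose e := (`|C0| + 1) * t ^+ 2.
have e0 : 0 < e by rewrite mulr_gt0 ?exprn_gt0// ltr_wpDl.
have bflow k y : X y -> `|observable Psibar k (x t y)| <= M.
  move=> Xy; apply: bD; have [_ + _ _] := hx _ Xy; apply.
  by rewrite ltW.
move=> xh Xxh; rewrite -mulrA -/e; apply: cV_norm_le => [|i].
  by rewrite mulr_ge0// ltW.
(* The coefficients of the i-th coordinate of the Euler step. *)
pose w : 'rV[R]_(d + m) := \row_k ((k == lshift m i)%:R + t * c i k).
have edmdK : is_edmd Psibar X (x t) (K t) by apply: hK; rewrite t0.
have xE y : observable Psibar (lshift m i) y = y i 0.
  by rewrite /observable /Psi col_mxEu.
have /(_ w) := rowE _ _ (lshift m i) _ _ edmdK bflow e0.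
have we y : X y -> `|residual Psibar (x t) w (lshift m i) y| <= e.
  move=> Xy; have -> : residual Psibar (x t) w (lshift m i) y =
      (x t y - (y + t *: f y)) i 0.
    rewrite /residual xE [RHS]mxE [X in _ = _ + X]mxE; congr (_ - _).
    rewrite [RHS]mxE [X in _ = _ + X]mxE (fE i _ (DX _ Xy)) /lincomb.
    under eq_bigr do rewrite mxE mulrDl -mulrA.
    rewrite big_split /= -mulr_sumr (bigD1 (lshift m i))//= eqxx mul1r xE.
    by rewrite big1 ?addr0// => k /negPf ->; rewrite mul0r.
  apply: le_trans (cV_coord_le _ _) _; apply: le_trans (texp _ Xy) _.
  by rewrite ler_wpM2r ?sqr_ge0// (le_trans (ler_norm _))// lerDl.
move=> /(_ we xh Xxh); rewrite -normrN; congr (`|_| <= _).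
rewrite /residual xE opprB F_piE [RHS]mxE [X in _ = _ + X]mxE; congr (_ - _).
rewrite [RHS]mxE; apply: eq_bigr => k _.
by rewrite [row _ _ _ _]mxE [usubmx _ _ _]mxE.
Unshelve. all: by end_near. Qed.
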